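(* Let $\alpha$ and $\lambda$ be constants satisfying $0<\lambda<1$ and $0<\alpha<\lambda(1-\lambda)$. There is a constant $c=c_{\alpha,\lambda}>0$ such that for every positive integer $n$ for which $d=\alpha n$ and $w=\lambda n$ are integers, $$A(n,d+1,w)\ge cn\cdot\frac{\binom nw}{V_w(n,d)}.$$
   Context: The Johnson distance between two binary words of length $n$ and the same weight (number of ones) is half of their Hamming distance. $A(n,m,w)$ is the largest size of a set of words in $\{0,1\}^n$, all of weight $w$, any two distinct of which have Johnson distance at least $m$. $V_w(n,d)=\sum_{i=0}^d\binom wi\binom{n-w}i$ is the volume of a Johnson ball of radius $d$ in $\binom{[n]}w$. *)

(* Defs.v *)
From mathcomp Require Import all_boot.

Set Implicit Arguments.
Unset Strict Implicit.
Unset Printing Implicit Defensive.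

Definition word (n : nat) := n.-tuple bool.

Definition weight n (x : word n) : nat := #|[set i | tnth x i]|.

Definition hamming_dist n (x y : word n) : nat :=
  #|[set i | tnth x i != tnth y i]|.

(* Only meaningful for words of equal weight: then the Hamming distance is
   even, so the truncated half is exact (see johnson_distK). *)
Definition johnson_dist n (x y : word n) : nat := (hamming_dist x y)./2.

Definition constant_weight_code n (m w : nat) (C : {set word n}) : bool :=
  [forall x in C, weight x == w] &&
  [forall x in C, forall y in C, (x != y) ==> (m <= johnson_dist x y)].

Definition A (n m w : nat) : nat :=
  \max_(C : {set word n} | constant_weight_code m w C) #|C|.

(* Johnson_ball_volume n d w is V_w(n,d). *)
Definition Johnson_ball_volume (n d w : nat) : nat :=
  \sum_(0 <= i < d.+1) 'C(w, i) * 'C(n - w, i).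

Lemma johnson_distK n (x y : word n) :
  weight x = weight y -> (johnson_dist x y).*2 = hamming_dist x y.
Proof.
rewrite /johnson_dist /weight => eq_w.
suff ->: hamming_dist x y = #|[set i | tnth x i & ~~ tnth y i]|.*2.
  by rewrite doubleK.
set X := [set i | tnth x i] in eq_w; set Y := [set i | tnth y i] in eq_w.
have -> : [set i | tnth x i & ~~ tnth y i] = X :\: Y.
  by apply/setP=> i; rewrite !inE andbC.
have -> : hamming_dist x y = #|(X :\: Y) :|: (Y :\: X)|.
  apply: eq_card => i; rewrite !inE.
  by case: (tnth x i); case: (tnth y i).
rewrite cardsU (_ : _ :&: _ = set0) ?cards0 ?subn0.
  by rewrite -addnn [in X in _ + X]cardsD -eq_w setIC -cardsD.
apply/setP=> i; rewrite !inE.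
by case: (tnth x i); case: (tnth y i).
Qed.

(* Main.v *)
Require Import Defs.
From mathcomp Require Import all_boot all_order all_algebra reals sequences exp.
From mathcomp Require Import ring lra zify.

(** Call two words close when their Johnson distance is at most d. A code of
    minimum distance d + 1 is an independent set of the closeness relation on
    the N = C(n, w) words of weight w, and every closed neighbourhood is a
    Johnson ball, of volume V. A maximal independent set has at least N / V
    elements ([gilbert_varshamov]); the extra factor n comes from the fact that
    the neighbourhoods are exponentially sparse.

    Sparsity: if Y and Z are drawn at random in the ball around v, almost all
    of the mass sits near radius d, because consecutive spheres grow by a factor
    at least 1 / rho > 1 when alpha < lambda (1 - lambda). At radius d, the sets
    v \ Y and v \ Z (and likewise Y \ v and Z \ v) overlap in a hypergeometric
    number of places, so that Y and Z are typically at distance about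
    d (2 - alpha / (lambda (1 - lambda))) > d. An exponential moment of the
    overlap turns this into: at most c^2 q^d V^2 pairs of the ball are close,
    with q < 1 ([johnson_ball_intersections]). Bounding the indicator of
    |Y \ Z| <= d by (1 + u)^(d - |Y \ Z|) makes the sum over the two radii
    factor into two geometric sums, so no separate treatment of small radii is
    needed.

    Large independent sets: draw an independent set I with probability
    proportional to mu^|I|, and look at D [v in I] + |I n ball v|, where D
    bounds the size of the balls. Condition on S = I \ ball v, and let X be the
    set of vertices of ball v that S leaves available. If X is small, the
    partition function of the conditional model is at most exp (mu |X|), so v
    itself is chosen often enough. If X is large, sparsity makes the model look
    like independent choices and |I n ball v| has mean at least mu |X| - 1
    ([fiber_occupancy]). Either way the mean is at least L, a quarter of the
    logarithm of the sparsity up to a constant. Summing over v counts each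
    element of I at most 2 D times, so some I has at least L N / (2 D) elements
    ([large_independent_set]). With D = V and K = c^2 q^d V^2 this L is a n - b
    for constants a > 0 and b, and the bound N / V takes care of the n for which
    a n - b is not of order n. *)

Set Implicit Arguments.
Unset Strict Implicit.
Unset Printing Implicit Defensive.

Import Order.TTheory GRing.Theory Num.Theory.
Local Open Scope ring_scope.

(** * Finite sums and cardinalities *)

Lemma sum_subsets_expr (R : comNzRingType) (T : finType) (X : {set T}) (t : R) :
  \sum_(J in powerset X) t ^+ #|J| = (1 + t) ^+ #|X|.
Proof.
rewrite exprDn (partition_big (fun J : {set T} => inord #|J| : 'I_#|X|.+1) xpredT) //=.
apply: eq_bigr => k _; rewrite expr1n mul1r -(cards_draws X) -sumr_const.
apply: eq_big => [J|J /andP[/[!powersetE] sJX /eqP <-]]; last first.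
  by rewrite inordK ?ltnS ?subset_leq_card.
rewrite inE powersetE; case: (boolP (J \subset X)) => //= sJX.
by rewrite -val_eqE /= inordK ?ltnS ?subset_leq_card.
Qed.

Lemma sum_setId (R : nmodType) (T : finType) (A : {set T}) (P : pred T) (F : T -> R) :
  \sum_(x in [set x in A | P x]) F x = \sum_(x in A | P x) F x.
Proof. by apply: eq_bigl => x; rewrite inE. Qed.

(** How weights are compared throughout: an injection that does not decrease
    weights. *)
Lemma ler_sum_inj (R : numDomainType) (S T : finType) (P : {set S}) (Q : {set T})
    (h : S -> T) (f : S -> R) (g : T -> R) :
  {in P &, injective h} -> {in P, forall x, h x \in Q} ->
  {in P, forall x, f x <= g (h x)} -> {in Q, forall y, 0 <= g y} ->
  \sum_(x in P) f x <= \sum_(y in Q) g y.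
Proof.
move=> h_inj hPQ le_fg g_ge0.
apply: (@le_trans _ _ (\sum_(y in [set h x | x in P]) g y)).
  by rewrite big_imset //; apply: ler_sum.
have /setIidPr <- : [set h x | x in P] \subset Q.
  by apply/subsetP => _ /imsetP[x xP ->]; apply: hPQ.
rewrite [leRHS](big_setID [set h x | x in P]) /= lerDl.
by apply: sumr_ge0 => y /setDP[yQ _]; apply: g_ge0.
Qed.

Lemma sum_mem (R : pzSemiRingType) (T : finType) (A B : {set T}) :
  \sum_(x in A) (x \in B)%:R = #|A :&: B|%:R :> R.
Proof.
rewrite -sum1_card natr_sum big_mkcond [RHS]big_mkcond /=.
by apply: eq_bigr => x _; rewrite inE; case: (x \in A); case: (x \in B).
Qed.

Lemma card_setD_sym (T : finType) (X Y : {set T}) :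
  #|X| = #|Y| -> #|X :\: Y| = #|Y :\: X|.
Proof.
move=> eqXY; apply: (@addnI #|X :&: Y|); rewrite cardsID eqXY.
by rewrite -(cardsID X Y) setIC.
Qed.

(** * Independent sets *)

(** The closed neighbourhood in U: closeness is reflexive below, so v belongs to
    its own ball. *)
Definition ball (T : finType) (U : {set T}) (close : rel T) (v : T) : {set T} :=
  [set y in U | close v y].

Definition independent (T : finType) (U : {set T}) (close : rel T) (I : {set T}) : bool :=
  (I \subset U) && [forall x in I, forall y in I, (x != y) ==> ~~ close x y].

Lemma independentP (T : finType) (U : {set T}) (close : rel T) (I : {set T}) :
  reflect ({subset I <= U} /\ {in I &, forall x y, close x y -> x = y})
          (independent U close I).
Proof.
apply: (iffP andP) => -[sIU sepI]; split.
- exact/subsetP.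
- move=> x y xI yI; apply: contraTeq => neq_xy.
  by move: sepI => /forall_inP/(_ x xI)/forall_inP/(_ y yI)/implyP; apply.
- exact/subsetP.
- apply/forall_inP => x xI; apply/forall_inP => y yI; apply/implyP.
  by apply: contra_neqN; apply: sepI.
Qed.

Lemma independentS (T : finType) (U : {set T}) (close : rel T) (I J : {set T}) :
  I \subset J -> independent U close J -> independent U close I.
Proof.
move=> /subsetP sIJ /independentP[sJU sepJ]; apply/independentP; split.
  by move=> x /sIJ/sJU.
by move=> x y /sIJ xJ /sIJ yJ; apply: sepJ.
Qed.

Lemma independentU1 (T : finType) (U : {set T}) (close : rel T) (y : T) (I : {set T}) :
  symmetric close -> y \in U -> {in I, forall x, ~~ close y x} ->
  independent U close I -> independent U close (y |: I).
Proof.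
move=> close_sym yU far /independentP[sIU sepI]; apply/independentP; split.
  by move=> x /setU1P[-> //|/sIU].
move=> x z /setU1P[->|xI] /setU1P[->|zI] //.
- by rewrite (negPf (far z zI)).
- by rewrite close_sym (negPf (far x xI)).
- exact: sepI.
Qed.

Lemma maximal_independent_set (T : finType) (U : {set T}) (close : rel T) (D : nat) :
  reflexive close -> symmetric close ->
  {in U, forall v, (#|ball U close v| <= D)%N} ->
  exists2 I, independent U close I & (#|U| <= #|I| * D)%N.
Proof.
move=> close_refl close_sym leD.
have ind0 : independent U close set0.
  by apply/independentP; split=> x; rewrite inE.
have [I /maxsetP[indI maxI] _] := maxset_exists ind0.
exists I => //; have [sIU _] := independentP _ _ _ indI.
have cov : U \subset \bigcup_(x in I) ball U close x.
  apply/subsetP => y yU; apply/bigcupP.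
  have [/exists_inP[x xI yx]|/exists_inPn far] := boolP [exists x in I, close y x].
    by exists x; rewrite // inE yU close_sym.
  exists y; last by rewrite inE yU close_refl.
  by rewrite -(maxI _ (independentU1 close_sym yU far indI) (subsetUr _ _)) setU11.
apply: leq_trans (subset_leq_card cov) _.
rewrite -sum_nat_const.
apply: (@leq_trans (\sum_(x in I) #|ball U close x|)); last first.
  by apply: leq_sum => x /sIU; apply: leD.
elim/big_rec2: _ => [|x m B _ leBm]; first by rewrite cards0.
by rewrite (leq_trans (leq_card_setU _ _)) // leq_add2l.
Qed.

(** * The hard-core model around one vertex *)

(** The independent sets that look like S outside the ball of v: the sample
    space once that outside part is given. *)
Definition fiber (T : finType) (U : {set T}) (close : rel T) (v : T) (S : {set T}) :
  {set {set T}} := [set I | independent U close I & I :\: ball U close v == S].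

(** When the fiber of S is inhabited, S misses the ball, and the members of the
    fiber add to S an independent subset of these vertices. *)
Definition available (T : finType) (U : {set T}) (close : rel T) (v : T) (S : {set T}) :
  {set T} := [set y in ball U close v | [forall s in S, ~~ close y s]].

Lemma fiber_add (T : finType) (U : {set T}) (close : rel T) (v y : T) (S I : {set T}) :
  symmetric close -> I \in fiber U close v S -> y \in available U close v S ->
  I :&: ball U close y = set0 -> y |: I \in fiber U close v S.
Proof.
move=> close_sym; rewrite !inE => /andP[indI /eqP defS] /andP[/andP[yU vy] _] I0.
apply/andP; split; last first.
  by rewrite setDUl defS (eqP (_ : _ :\: _ == set0)) ?set0U // setD_eq0 sub1set inE yU.
apply: independentU1 => // x xI; have [sIU _] := independentP _ _ _ indI.
apply/negP => yx; move/setP/(_ x): I0.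
by rewrite !inE xI (sIU x xI) yx.
Qed.

Lemma fiber_available (T : finType) (U : {set T}) (close : rel T) (v : T) (S I : {set T}) :
  I \in fiber U close v S ->
  I :&: ball U close v \subset available U close v S.
Proof.
rewrite inE => /andP[/independentP[_ sepI] /eqP <-].
apply/subsetP => y /setIP[yI yB]; rewrite inE yB /=.
apply/forall_inP => s /setDP[sI sB]; apply: contra sB => ys.
by rewrite -(sepI _ _ yI sI ys).
Qed.

(** Forgetting that I must be independent inside the ball, each available vertex
    contributes a factor 1 + mu. *)
Lemma fiber_sum_le (R : numDomainType) (T : finType) (U : {set T}) (close : rel T) (v : T)
    (S : {set T}) (mu : R) :
  0 <= mu ->
  \sum_(I in fiber U close v S) mu ^+ #|I| <=
    mu ^+ #|S| * (1 + mu) ^+ #|available U close v S|.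
Proof.
move=> mu_ge0; rewrite -sum_subsets_expr big_distrr /=.
apply: (@ler_sum_inj _ _ _ _ _ (fun I => I :&: ball U close v)) => [I J|I|I|J _].
- rewrite !inE => /andP[_ /eqP defI] /andP[_ /eqP defJ] eqIJ.
  by rewrite -(setID I (ball U close v)) -(setID J (ball U close v)) eqIJ defI defJ.
- by move/fiber_available; rewrite powersetE.
- rewrite inE => /andP[_ /eqP <-].
  by rewrite -exprD addnC cardsID.
- by rewrite mulr_ge0 ?exprn_ge0.
Qed.

(** S misses the ball, that is, the closed neighbourhood of v, so v |: S is itself
    in the fiber. *)
Lemma fiber_center (R : numDomainType) (T : finType) (U : {set T}) (close : rel T) (v : T)
    (S : {set T}) (mu : R) :
  0 <= mu -> reflexive close -> symmetric close -> v \in U ->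
  fiber U close v S != set0 ->
  mu * mu ^+ #|S| <= \sum_(I in fiber U close v S | v \in I) mu ^+ #|I|.
Proof.
move=> mu_ge0 close_refl close_sym vU /set0Pn[I0 I0F].
have := I0F; rewrite inE => /andP[indI0 /eqP defS].
have indS : independent U close S.
  by apply: independentS indI0; rewrite -defS subsetDl.
have SB : S :&: ball U close v = set0.
  by rewrite -defS setIC setIDA setIC -setIDA setDv setI0.
have SF : S \in fiber U close v S by rewrite inE indS -{1}defS setDDl setUid defS eqxx.
have [sSU _] := independentP _ _ _ indS.
have vA : v \in available U close v S.
  rewrite !inE vU close_refl /=; apply/forall_inP => s sS; apply/negP => vs.
  by move/setP/(_ s): SB; rewrite !inE sS (sSU s sS) vs.
have vSF := fiber_add close_sym SF vA SB.
have vNS : v \notin S.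
  by apply/negP => vS; move/setP/(_ v): SB; rewrite !inE vS vU close_refl.
rewrite (bigD1 (v |: S)) /=; last by rewrite vSF setU11.
rewrite cardsU1 vNS exprS lerDl.
by apply: sumr_ge0 => *; rewrite exprn_ge0.
Qed.

(** Removing z keeps a set in the fiber and divides its weight by mu. *)
Lemma fiber_point_le (R : numDomainType) (T : finType) (U : {set T}) (close : rel T) (v z : T)
    (S : {set T}) (mu : R) :
  0 <= mu -> z \in ball U close v ->
  \sum_(I in fiber U close v S | z \in I) mu ^+ #|I| <=
    mu * \sum_(I in fiber U close v S) mu ^+ #|I|.
Proof.
move=> mu_ge0 zB; rewrite big_distrr /= -sum_setId.
apply: (@ler_sum_inj _ _ _ _ _ (fun I => I :\ z)) => [I J|I|I|J _].
- rewrite !inE => /andP[_ zI] /andP[_ zJ] eqIJ.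
  by rewrite -(setD1K zI) -(setD1K zJ) eqIJ.
- rewrite !inE => /andP[/andP[indI /eqP defS] zI].
  rewrite (independentS (subD1set I z) indI) /=.
  by rewrite setDDl (setUidPr _) ?sub1set // defS.
- by rewrite inE => /andP[_ zI]; rewrite -exprS [in leLHS](cardsD1 z) zI.
- by rewrite mulr_ge0 ?exprn_ge0.
Qed.

(** Adding y multiplies the weight by mu and is legal as soon as I has no element
    close to y. An element of I close to the available vertex y lies in the ball
    of v, so the failures are counted by the common neighbours of v and y, each
    of which occurs with probability at most mu. *)
Lemma fiber_point_ge (R : numDomainType) (T : finType) (U : {set T}) (close : rel T) (v y : T)
    (S : {set T}) (mu : R) :
  0 <= mu -> reflexive close -> symmetric close -> y \in available U close v S ->
  mu * (1 - mu * #|ball U close v :&: ball U close y|%:R) *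
     \sum_(I in fiber U close v S) mu ^+ #|I| <=
    \sum_(I in fiber U close v S | y \in I) mu ^+ #|I|.
Proof.
move=> mu_ge0 close_refl close_sym yA; set F := fiber U close v S.
set Z := \sum_(I in F) _; set B := ball U close v; set By := ball U close y.
have yU : y \in U by move: yA; rewrite !inE => /andP[/andP[]].
pose free I := I :&: By == set0.
apply: (@le_trans _ _ (mu * \sum_(I in F | free I) mu ^+ #|I|)); last first.
  rewrite big_distrr /= -!sum_setId.
  apply: (@ler_sum_inj _ _ _ _ _ (fun I => y |: I)) => [I J|I|I|J _];
    last by rewrite exprn_ge0.
  - have yN K : K \in [set I in F | free I] -> y \notin K.
      rewrite inE => /andP[_ /eqP/setP/(_ y)]; rewrite !inE yU close_refl !andbT.
      by move->.
    by move=> /yN yI /yN yJ eqIJ; rewrite -(setU1K yI) -(setU1K yJ) eqIJ.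
  - by rewrite in_set => /andP[IF /eqP I0]; rewrite in_set setU11 andbT; apply: fiber_add.
  - rewrite inE => /andP[_ /eqP/setP/(_ y)]; rewrite !inE yU close_refl !andbT => yI.
    by rewrite cardsU1 yI exprS.
rewrite -mulrA ler_wpM2l // mulrBl mul1r lerBlDr.
(* union bound over the element z of I that blocks y *)
rewrite {1}/Z (bigID free) /= lerD2l.
apply: (@le_trans _ _ (\sum_(z in B :&: By) \sum_(I in F | z \in I) mu ^+ #|I|)).
  rewrite (exchange_big_dep (mem F)) /=; last by move=> ? ? _ /andP[].
  rewrite [leRHS](bigID free) /= -[leLHS]add0r lerD //.
    by apply: sumr_ge0 => I _; apply: sumr_ge0 => *; rewrite exprn_ge0.
  apply: ler_sum => I /andP[IF /set0Pn[z /setIP[zI zBy]]].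
  have zB : z \in B.
    move: yA IF; rewrite !inE => /andP[_ /forall_inP far] /andP[_ /eqP defS].
    move: zBy; rewrite inE => /andP[zU yz]; rewrite zU /=.
    apply: contraLR yz => vz; apply: far; rewrite -defS !inE zI zU andbT.
    exact: vz.
  rewrite (bigD1 z) /=; last by rewrite inE zB zBy IF.
  by rewrite lerDl sumr_ge0 // => *; rewrite exprn_ge0.
rewrite -mulrA mulrCA mulr_natl -sumr_const; apply: ler_sum => z /setIP[zB _].
exact: fiber_point_le.
Qed.

(** The local estimate. K bounds the number of ordered close pairs in the ball, and
    mu^2 K <= 1 implies that a mu-random subset of the ball spans less than one
    edge on average. The dichotomy is on the number of available vertices. *)
Lemma fiber_occupancy (R : realType) (T : finType) (U : {set T}) (close : rel T) (v : T)
    (S : {set T}) (mu D K L : R) :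
  reflexive close -> symmetric close -> v \in U -> 0 <= mu -> 0 <= D -> 0 <= L ->
  (\sum_(y in ball U close v) #|ball U close v :&: ball U close y|)%:R <= K ->
  mu ^+ 2 * K <= 1 -> L * expR (L + 1) <= D * mu ->
  L * \sum_(I in fiber U close v S) mu ^+ #|I| <=
    \sum_(I in fiber U close v S)
       mu ^+ #|I| * (D * (v \in I)%:R + #|I :&: ball U close v|%:R).
Proof.
move=> close_refl close_sym vU mu_ge0 D_ge0 L_ge0 leK muK leD.
set F := fiber U close v S; set B := ball U close v; set X := available U close v S.
have [->|F0] := eqVneq F set0; first by rewrite !big_set0 mulr0.
set Z := \sum_(I in F) _.
have Z_ge0 : 0 <= Z by apply: sumr_ge0 => *; rewrite exprn_ge0.
set W := mu ^+ #|S|.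
have W_ge0 : 0 <= W by rewrite exprn_ge0.
have sXB : X \subset B by apply/subsetP => y; rewrite inE => /andP[].
have center := fiber_center mu_ge0 close_refl close_sym vU F0.
have Z_le : Z <= W * (1 + mu) ^+ #|X| := fiber_sum_le U close v S mu_ge0.
have -> : \sum_(I in F) mu ^+ #|I| * (D * (v \in I)%:R + #|I :&: B|%:R) =
   D * \sum_(I in F | v \in I) mu ^+ #|I| +
   \sum_(y in B) \sum_(I in F | y \in I) mu ^+ #|I|.
  rewrite (exchange_big_dep (mem F)) /=; last by move=> ? ? _ /andP[].
  rewrite big_distrr /= [X in _ = X + _]big_mkcondr -big_split /=.
  apply: eq_bigr => I IF; rewrite mulrDr; congr (_ + _).
    by case: ifP => _; rewrite ?mulr1 ?mulr0 // mulrC.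
  rewrite mulr_natr -sumr_const; apply: eq_bigl => y.
  by rewrite inE IF /= andbC.
have center' : D * (mu * W) <= D * \sum_(I in F | v \in I) mu ^+ #|I|.
  exact: ler_wpM2l.
have points : (mu * #|X|%:R - 1) * Z <= \sum_(y in B) \sum_(I in F | y \in I) mu ^+ #|I|.
  apply: (@le_trans _ _ (\sum_(y in X) mu * (1 - mu * #|B :&: ball U close y|%:R) * Z)).
    rewrite -mulr_suml ler_wpM2r // -mulr_sumr sumrB -mulr_sumr sumr_const mulrBr.
    rewrite lerD2l lerN2 mulrA -expr2 (le_trans _ muK) // ler_wpM2l ?exprn_ge0 //.
    rewrite -natr_sum (le_trans _ leK) // ler_nat [leqRHS](big_setID X) /=.
    by rewrite (setIidPr sXB) leq_addr.
  apply: (@le_trans _ _ (\sum_(y in X) \sum_(I in F | y \in I) mu ^+ #|I|)).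
    by apply: ler_sum => y yX; apply: fiber_point_ge.
  rewrite [leRHS](big_setID X) /= (setIidPr sXB) lerDl.
  by apply: sumr_ge0 => y _; apply: sumr_ge0 => *; rewrite exprn_ge0.
have pts_ge0 : 0 <= \sum_(y in B) \sum_(I in F | y \in I) mu ^+ #|I|.
  by apply: sumr_ge0 => y _; apply: sumr_ge0 => *; rewrite exprn_ge0.
(* If mu |X| - 1 >= L the points of the ball suffice; otherwise the partition
   function is at most exp (L + 1) times the weight of S, and v suffices. *)
have [large|small] := leP L (mu * #|X|%:R - 1).
  apply: (@le_trans _ _ ((mu * #|X|%:R - 1) * Z)); first exact: ler_wpM2r.
  apply: (le_trans points); rewrite lerDr.
  by apply: le_trans center'; rewrite !mulr_ge0.
apply: (@le_trans _ _ (D * (mu * W))); last by lra.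
rewrite mulrA; apply: le_trans (ler_wpM2r W_ge0 leD).
rewrite -mulrA ler_wpM2l // mulrC (le_trans Z_le) // ler_wpM2l //.
apply: (@le_trans _ _ (expR mu ^+ #|X|)).
  by rewrite lerXn2r ?nnegrE ?addr_ge0 ?expR_ge0 ?expR_ge1Dx.
by rewrite -expRM_natr ler_expR; lra.
Qed.

(** For D^2 / K large, the largest admissible L is a quarter of ln (D^2 / K) minus
    1/2: a logarithmic gain over the trivial bound |U| / D. *)
Lemma large_independent_set (R : realType) (T : finType) (U : {set T}) (close : rel T)
    (D K L : R) :
  reflexive close -> symmetric close -> 0 < D -> 0 <= L ->
  {in U, forall v, #|ball U close v|%:R <= D} ->
  {in U, forall v,
    (\sum_(y in ball U close v) #|ball U close v :&: ball U close y|)%:R <= K} ->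
  K * expR (4 * L + 2) <= D ^+ 2 ->
  exists2 I, independent U close I & L * #|U|%:R <= 2 * D * #|I|%:R.
Proof.
move=> close_refl close_sym D_gt0 L_ge0 leD leK KD.
(* For this fugacity the hypothesis on K reads mu^2 K <= 1, and L <= exp L gives
   L exp (L + 1) <= D mu. *)
pose mu := expR (2 * L + 1) / D.
have mu_gt0 : 0 < mu by rewrite divr_gt0 ?expR_gt0.
have mu_ge0 := ltW mu_gt0.
have muK : mu ^+ 2 * K <= 1.
  rewrite expr_div_n mulrAC ler_pdivrMr ?exprn_gt0 // mul1r mulrC.
  by rewrite -expRM_natr (_ : _ * 2 = 4 * L + 2) //; ring.
have LD : L * expR (L + 1) <= D * mu.
  rewrite /mu mulrC mulrA [D * _]mulrC mulfK ?gt_eqF //.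
  rewrite (_ : 2 * L + 1 = L + 1 + L); last by ring.
  rewrite [leRHS]expRD ler_wpM2l ?expR_ge0 //.
  by apply: le_trans (expR_ge1Dx _); lra.
set ind := [set I | independent U close I].
have total : L * #|U|%:R * \sum_(I in ind) mu ^+ #|I| <=
   \sum_(I in ind) mu ^+ #|I| * (2 * D * #|I|%:R).
  apply: (@le_trans _ _ (\sum_(v in U) \sum_(I in ind)
       mu ^+ #|I| * (D * (v \in I)%:R + #|I :&: ball U close v|%:R))).
    rewrite [L * _]mulrC -mulrA mulr_natl -sumr_const; apply: ler_sum => v vU.
    rewrite (partition_big (fun I => I :\: ball U close v) xpredT) //=.
    rewrite [leRHS](partition_big (fun I => I :\: ball U close v) xpredT) //=.
    rewrite big_distrr /=; apply: ler_sum => S _.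
    have fE G : \sum_(I in ind | I :\: ball U close v == S) G I =
      \sum_(I in fiber U close v S) G I :> R.
      by apply: eq_bigl => I; rewrite !inE.
    rewrite !fE; apply: (fiber_occupancy _ close_refl close_sym vU mu_ge0 (ltW D_gt0) L_ge0 (leK v vU)) => //.
  (* x in I is counted D times as a centre and once per ball that contains it *)
  rewrite exchange_big /=; apply: ler_sum => I; rewrite inE => /independentP[sIU _].
  rewrite -mulr_sumr ler_wpM2l ?exprn_ge0 // big_split /=.
  rewrite -mulr_sumr sum_mem (setIidPr _); last exact/subsetP.
  have -> : \sum_(v in U) #|I :&: ball U close v|%:R = \sum_(y in I) #|ball U close y|%:R :> R.
    under eq_bigr do rewrite -sum_mem.
    rewrite exchange_big /=; apply: eq_bigr => y yI.
    rewrite -(_ : U :&: ball U close y = ball U close y) -?sum_mem; last first.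
      by apply/setIidPr/subsetP => z; rewrite inE => /andP[].
    by apply: eq_bigr => v vU; rewrite !inE vU sIU // close_sym.
  have : \sum_(y in I) #|ball U close y|%:R <= \sum_(y in I) D.
    by apply: ler_sum => y /sIU; apply: leD.
  by rewrite sumr_const -mulr_natr; lra.
have : ~~ [forall I in ind, 2 * D * #|I|%:R < L * #|U|%:R].
  apply/negP => /forall_inP lt.
  suff : \sum_(I in ind) mu ^+ #|I| * (2 * D * #|I|%:R) <
         \sum_(I in ind) mu ^+ #|I| * (L * #|U|%:R).
    by rewrite -mulr_suml [ltRHS]mulrC => /(le_lt_trans total); rewrite ltxx.
  have ind0 : set0 \in ind.
    by rewrite inE; apply/independentP; split=> x; rewrite inE.
  rewrite (bigD1 set0) // [ltRHS](bigD1 set0) //=.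
  apply: ltr_leD; first by rewrite ltr_pM2l ?exprn_gt0 ?lt.
  by apply: ler_sum => I /andP[/lt /ltW ltI _]; rewrite ler_wpM2l ?exprn_ge0.
rewrite negb_forall_in => /exists_inP[I]; rewrite inE -leNgt => indI leI.
by exists I.
Qed.

(** * Exponential moments of hypergeometric laws *)

(** The probability that a random j-subset of an m-set contains k given points is
    at most (j / m)^k: sampling without replacement is negatively correlated. *)
Lemma bin_shift_le (m j k : nat) : (k <= j)%N -> (j <= m)%N ->
  ('C(m - k, j - k) * m ^ k <= 'C(m, j) * j ^ k)%N.
Proof.
move=> + lejm; elim: k => [|k IHk] ltkj; first by rewrite !subn0.
have step : ('C(m - k.+1, j - k.+1) * m <= 'C(m - k, j - k) * j)%N.
  rewrite -(@leq_pmul2l (m - k)) ?subn_gt0 ?(leq_trans ltkj) // mulnA.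
  rewrite !subnS mul_bin_diag prednK ?subn_gt0 // mulnAC [leqRHS]mulnCA [leqRHS]mulnC.
  by rewrite leq_mul2r !mulnBl [(j * m)%N]mulnC leq_sub2l ?orbT // leq_mul2l lejm orbT.
rewrite !expnS mulnA (leq_trans (leq_mul step (leqnn _))) // mulnAC.
by rewrite [leqRHS]mulnCA mulnC leq_mul2l IHk ?orbT // ltnW.
Qed.

Definition draws (T : finType) (U : {set T}) (j : nat) : {set {set T}} :=
  [set X : {set T} | X \subset U & #|X| == j].

Lemma card_draws_superset (T : finType) (U A : {set T}) (j : nat) :
  A \subset U -> (#|A| <= j)%N ->
  #|[set X in draws U j | A \subset X]| = 'C(#|U| - #|A|, j - #|A|).
Proof.
move=> sAU leAj; rewrite -(cardsDS sAU) -cards_draws.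
rewrite [in RHS](_ : [set _ | _] = [set X :\: A | X in [set X in draws U j | A \subset X]]).
  rewrite card_in_imset // => X Y; rewrite !inE => /andP[_ sAX] /andP[_ sAY] eqXY.
  by rewrite -(setID X A) -(setID Y A) eqXY (setIidPr sAX) (setIidPr sAY).
apply/setP => Y; apply/idP/imsetP => [|[X]].
  rewrite !inE subsetD => /andP[/andP[sYU dYA] /eqP cY].
  exists (Y :|: A); last by rewrite setDUl setDv setU0; apply/esym/setDidPl.
  rewrite !inE subUset sYU sAU subsetUr andbT /=.
  by move: dYA; rewrite -leq_card_setU => /eqP ->; rewrite cY subnK.
rewrite !inE => /andP[/andP[sXU /eqP cX] sAX] ->.
by rewrite setSD //= cardsDS // cX.
Qed.

Lemma draws_superset_le (T : finType) (U A : {set T}) (j : nat) :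
  A \subset U -> (j <= #|U|)%N ->
  (#|[set X in draws U j | A \subset X]| * #|U| ^ #|A| <= 'C(#|U|, j) * j ^ #|A|)%N.
Proof.
move=> sAU lejU; have [leAj|ltjA] := leqP #|A| j.
  by rewrite card_draws_superset // bin_shift_le.
rewrite (_ : [set X in _ | _] = set0) ?cards0 ?mul0n //.
apply/setP => X; rewrite !inE; apply/negbTE/negP => /andP[/andP[_ /eqP cX] /subset_leq_card].
by rewrite cX leqNgt ltjA.
Qed.

(** Expand (1 + u)^|A n X| over the subsets J of A n X and exchange the sums: the
    hypergeometric law has smaller factorial moments than the binomial law of
    parameters |A| and j / |U|. *)
Lemma hypergeometric_mgf (R : realType) (T : finType) (U A : {set T}) (j : nat) (u : R) :
  A \subset U -> (j <= #|U|)%N -> (0 < #|U|)%N -> 0 <= u ->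
  \sum_(X in draws U j) (1 + u) ^+ #|A :&: X| <=
    'C(#|U|, j)%:R * (1 + u * (j%:R / #|U|%:R)) ^+ #|A|.
Proof.
move=> sAU lejU U_gt0 u_ge0.
under eq_bigr do rewrite -sum_subsets_expr.
rewrite (exchange_big_dep (mem (powerset A))) /=; last first.
  by move=> X J _; rewrite !powersetE subsetI => /andP[].
rewrite -sum_subsets_expr big_distrr /=; apply: ler_sum => J; rewrite powersetE => sJA.
rewrite (eq_bigl (fun X => X \in [set X in draws U j | J \subset X])); last first.
  by move=> X; rewrite [in RHS]inE powersetE subsetI sJA.
rewrite sumr_const exprMn mulrCA -[leLHS]mulr_natr ler_wpM2l ?exprn_ge0 //.
rewrite expr_div_n mulrA ler_pdivlMr ?exprn_gt0 ?ltr0n // -!natrX -!natrM ler_nat.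
by rewrite draws_superset_le // (subset_trans sJA).
Qed.

(** * Intersections of Johnson balls *)

Definition sphere (T : finType) (v : {set T}) (j : nat) : {set {set T}} :=
  [set Z : {set T} | #|Z| == #|v| & #|v :\: Z| == j].

(** A set Z of the size of v is the same thing as the part that it loses and the
    part that it gains, which can be chosen independently. *)
Lemma sum_sphere (R : comPzSemiRingType) (T : finType) (v : {set T}) (j : nat)
    (F G : {set T} -> R) :
  \sum_(Z in sphere v j) F (v :\: Z) * G (Z :\: v) =
    (\sum_(X in draws v j) F X) * (\sum_(X in draws (~: v) j) G X).
Proof.
rewrite big_distrlr /= pair_big /=.
rewrite (reindex_onto (fun Z : {set T} => (v :\: Z, Z :\: v))
                      (fun p => (v :\: p.1) :|: p.2)) /=; last first.
  move=> [X Y]; rewrite !inE /= => /andP[/andP[sXv _] /andP[sYv _]].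
  have sXv' i := subsetP sXv i; have sYv' i := subsetP sYv i.
  congr (_, _); apply/setP => i; move: (sXv' i) (sYv' i); rewrite !inE.
    by case: (i \in v); case: (i \in X); case: (i \in Y) => //= H1 H2; (have := H1 isT) || (have := H2 isT).
  by case: (i \in v); case: (i \in X); case: (i \in Y) => //= H1 H2; (have := H1 isT) || (have := H2 isT).
apply: eq_bigl => Z; rewrite !inE subsetDl /= subDset setUCr subsetT /=.
have -> : (v :\: (v :\: Z)) :|: (Z :\: v) == Z.
  by apply/eqP/setP => i; rewrite !inE; case: (i \in v); case: (i \in Z).
rewrite andbT.
have := cardsID v Z; have := cardsID Z v; rewrite setIC => <- <-.
by rewrite eqn_add2l andbC; case: eqP => //= ->.
Qed.

Lemma card_sphere (T : finType) (v : {set T}) (j : nat) :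
  #|sphere v j| = ('C(#|v|, j) * 'C(#|T| - #|v|, j))%N.
Proof.
have prod1 : (\sum_(Z in sphere v j) 1 =
    (\sum_(X in draws v j) 1) * (\sum_(X in draws (~: v) j) 1))%N.
  exact: (sum_sphere v j (fun=> 1%N) (fun=> 1%N)).
by move: prod1; rewrite !sum1_card !cards_draws [#|~: v|]cardsCs setCK.
Qed.

Definition johnson_ball (T : finType) (d : nat) (v : {set T}) : {set {set T}} :=
  [set Z : {set T} | #|Z| == #|v| & (#|v :\: Z| <= d)%N].

Lemma sum_johnson_ball (R : nmodType) (T : finType) (d : nat) (v : {set T})
    (F : {set T} -> R) :
  \sum_(Z in johnson_ball d v) F Z = \sum_(j < d.+1) \sum_(Z in sphere v j) F Z.
Proof.
rewrite (partition_big (fun Z => inord #|v :\: Z| : 'I_d.+1) xpredT) //=.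
apply: eq_bigr => j _; apply: eq_bigl => Z; rewrite !inE -andbA; congr (_ && _).
rewrite -val_eqE /=; have [leZd|ltdZ] := leqP #|v :\: Z| d.
  by rewrite inordK.
by apply/esym/negbTE; rewrite gtn_eqF // (leq_trans (ltn_ord j)).
Qed.

Lemma card_johnson_ball (T : finType) (d : nat) (v : {set T}) :
  #|johnson_ball d v| = Johnson_ball_volume #|T| d #|v|.
Proof.
rewrite -sum1_card sum_johnson_ball /Johnson_ball_volume big_mkord.
by apply: eq_bigr => j _; rewrite sum1_card card_sphere.
Qed.

(** The distance from Y to Z falls short of the sum of their distances to v by the
    overlap of what they lose and the overlap of what they gain. *)
Lemma card_setD_triangle (T : finType) (v Y Z : {set T}) :
  #|Y| = #|v| -> #|Z| = #|v| ->
  (#|Y :\: Z| + #|(v :\: Y) :&: (v :\: Z)| + #|(Y :\: v) :&: (Z :\: v)| =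
     #|v :\: Y| + #|v :\: Z|)%N.
Proof.
move=> cY cZ.
rewrite (card_setD_sym (esym cY)).
rewrite -(cardsID (v :\: Y) (v :\: Z)) -[in RHS](cardsID (Z :\: v) (Y :\: v)).
rewrite -(cardsID v (Y :\: Z)) [(v :\: Y) :&: _]setIC.
have -> : (Y :\: Z) :&: v = (v :\: Z) :\: (v :\: Y).
  by apply/setP => i; rewrite !inE; case: (i \in v); case: (i \in Y); case: (i \in Z).
have -> : (Y :\: Z) :\: v = (Y :\: v) :\: (Z :\: v).
  by apply/setP => i; rewrite !inE; case: (i \in v); case: (i \in Y); case: (i \in Z).
lia.
Qed.

(** On a sphere the two overlaps with Y are independent and hypergeometric. Their
    success probabilities, j / |v| and j / (n - |v|), are replaced by the values
    at j = d so that the dependence on the two radii i and j separates. *)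
Lemma sphere_mgf (R : realType) (T : finType) (v Y : {set T}) (d i j : nat) (u : R) :
  0 <= u -> (0 < #|v|)%N -> (0 < #|T| - #|v|)%N ->
  (d <= #|v|)%N -> (d <= #|T| - #|v|)%N ->
  (j <= d)%N -> Y \in sphere v i ->
  \sum_(Z in sphere v j) (1 + u) ^- #|Y :\: Z| <=
    ('C(#|v|, j) * 'C(#|T| - #|v|, j))%:R * (1 + u) ^- (i + j) *
    ((1 + u * (d%:R / #|v|%:R)) * (1 + u * (d%:R / (#|T| - #|v|)%:R))) ^+ i.
Proof.
move=> u_ge0 v_gt0 vC_gt0 led1 led2 lejd; rewrite inE => /andP[/eqP cY /eqP dY].
have u1_gt0 : 0 < 1 + u by rewrite ltr_pwDl.
have u1_ge0 := ltW u1_gt0.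
have cvC : #|~: v| = (#|T| - #|v|)%N by rewrite cardsCs setCK.
have dY' : #|Y :\: v| = i by rewrite card_setD_sym.
apply: (@le_trans _ _ ((1 + u) ^- (i + j) *
   \sum_(Z in sphere v j) (1 + u) ^+ #|(v :\: Y) :&: (v :\: Z)| *
                          (1 + u) ^+ #|(Y :\: v) :&: (Z :\: v)|)).
  rewrite big_distrr /=; apply: ler_sum => Z; rewrite inE => /andP[/eqP cZ /eqP dZ].
  rewrite -exprD mulrC ler_pdivlMr ?exprn_gt0 //.
  rewrite -dY -dZ -(card_setD_triangle cY cZ) -addnA exprD mulKf ?expf_neq0 ?gt_eqF //.
rewrite (sum_sphere v j (fun X => (1 + u) ^+ #|(v :\: Y) :&: X|)
                        (fun X => (1 + u) ^+ #|(Y :\: v) :&: X|)).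
rewrite [_%:R * _ ^- _]mulrC -mulrA ler_wpM2l ?invr_ge0 ?exprn_ge0 //.
rewrite natrM exprMn mulrACA.
have mgf (V A : {set T}) : A \subset V -> #|A| = i -> (0 < #|V|)%N -> (d <= #|V|)%N ->
  \sum_(X in draws V j) (1 + u) ^+ #|A :&: X| <=
     'C(#|V|, j)%:R * (1 + u * (d%:R / #|V|%:R)) ^+ i.
  move=> sAV cA V_gt0 ledV.
  rewrite (le_trans (hypergeometric_mgf sAV _ V_gt0 u_ge0)) ?(leq_trans lejd) //.
  rewrite cA ler_wpM2l // lerXn2r ?nnegrE ?addr_ge0 ?mulr_ge0 ?invr_ge0 //.
  by rewrite lerD2l ler_wpM2l // ler_wpM2r ?invr_ge0 // ler_nat.
rewrite ler_pM ?sumr_ge0 // => [? _|? _| |]; rewrite ?exprn_ge0 //.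
  by rewrite mgf // ?subsetDl.
by rewrite -cvC mgf ?cvC // setDE subsetIr.
Qed.

(** A sequence that grows by a factor at least 1 / rho has its sum, even tilted by
    t^i with t > rho, dominated by the last term: c is at least t / (t - rho), the sum of the
    geometric series of ratio rho / t. *)
Lemma geometric_tail (R : numFieldType) (s : nat -> R) (rho t c : R) (d : nat) :
  (forall i, 0 <= s i) -> (forall i, (i < d)%N -> s i <= rho * s i.+1) ->
  0 <= t -> 1 <= c -> t <= c * (t - rho) ->
  \sum_(i < d.+1) s i * t ^+ i <= c * (s d * t ^+ d).
Proof.
move=> s_ge0 + t_ge0 c1 tc; have c_ge0 : 0 <= c := le_trans ler01 c1.
elim: d => [|d IHd] s_le.
  by rewrite big_ord_recr big_ord0 /= add0r ler_peMl // mulr_ge0 ?exprn_ge0.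
rewrite big_ord_recr /=.
have IH := IHd (fun i ltid => s_le i (ltnW ltid)).
apply: le_trans (lerD IH (lexx _)) _.
have step : c * (s d * t ^+ d) <= c * (rho * s d.+1 * t ^+ d).
  by rewrite ler_wpM2l // ler_wpM2r ?exprn_ge0 // s_le.
apply: le_trans (lerD step (lexx _)) _.
rewrite exprS -subr_ge0.
rewrite (_ : _ - _ = s d.+1 * t ^+ d * (c * (t - rho) - t)); last by ring.
by rewrite !mulr_ge0 ?exprn_ge0 ?subr_ge0.
Qed.

(** The hypothesis on rho says that spheres of radius less than d grow by a factor
    at least 1 / rho. In the sum over the radii i and j the weight
    (1 + u)^(d - i - j) g^i, with g the numerator of the fraction, splits into the
    tilts g / (1 + u) for i and 1 / (1 + u) for j; both sums live at radius d,
    which leaves (g / (1 + u))^d. *)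
Lemma johnson_ball_intersections (R : realType) (T : finType) (v : {set T}) (d : nat)
    (u rho c : R) :
  0 <= u -> 0 <= rho -> rho * (1 + u) < 1 -> c = (1 - rho * (1 + u))^-1 ->
  (0 < #|v|)%N -> (0 < #|T| - #|v|)%N ->
  (d <= #|v|)%N -> (d <= #|T| - #|v|)%N ->
  d%:R ^+ 2 <= rho * (#|v| - d)%:R * (#|T| - #|v| - d)%:R ->
  (\sum_(Y in johnson_ball d v) #|johnson_ball d v :&: johnson_ball d Y|)%:R <=
    c ^+ 2 *
    ((1 + u * (d%:R / #|v|%:R)) * (1 + u * (d%:R / (#|T| - #|v|)%:R)) / (1 + u)) ^+ d *
    (Johnson_ball_volume #|T| d #|v|)%:R ^+ 2.
Proof.
move=> u_ge0 rho_ge0 rho_lt c_def v_gt0 vC_gt0 led1 led2 rhod.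
set w := #|v| in v_gt0 led1 rhod *; set w' := (#|T| - w)%N in vC_gt0 led2 rhod *.
set g := (1 + u * _) * _.
have u1_gt0 : 0 < 1 + u by rewrite ltr_pwDl.
have u1_ge0 := ltW u1_gt0.
have g_ge1 : 1 <= g.
  by rewrite /g mulr_ege1 // lerDl !mulr_ge0 ?invr_ge0.
pose s i : R := ('C(w, i) * 'C(w', i))%:R.
have s_ge0 i : 0 <= s i by rewrite ler0n.
have s_le i : (i < d)%N -> s i <= rho * s i.+1.
  move=> ltid; rewrite -(ler_pM2l (_ : 0 < (i.+1 * i.+1)%:R)) ?ltr0n ?muln_gt0 //.
  rewrite mulrCA /s -!natrM [in leRHS]mulnACA !mul_bin_left [in leRHS]mulnACA !natrM [leRHS]mulrA.
  rewrite ler_wpM2r ?mulr_ge0 // (@le_trans _ _ (d%:R ^+ 2)) //.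
    by rewrite -natrM -natrX ler_nat -mulnn leq_mul.
  rewrite (le_trans rhod) // -!mulrA ler_wpM2l // -!natrM ler_nat.
  by rewrite leq_mul // leq_sub2l // ltnW.
have c_gt0 : 0 < c by rewrite c_def invr_gt0 subr_gt0.
have c_eq : c * (1 - rho * (1 + u)) = 1 by rewrite c_def mulVf // gt_eqF ?subr_gt0.
have c_ge1 : 1 <= c by rewrite c_def invf_ge1 ?subr_gt0 // gerBl mulr_ge0 // ltW.
(* c is t / (t - rho) at the smallest tilt t = 1 / (1 + u), and that ratio
   decreases in t *)
have tail t : (1 + u)^-1 <= t ->
    \sum_(i < d.+1) s i * t ^+ i <= c * (s d * t ^+ d).
  move=> ut; have t_ge0 : 0 <= t by rewrite (le_trans _ ut) ?invr_ge0.
  apply: (@geometric_tail _ s rho) => //.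
  have : c * ((1 + u)^-1 - rho) = (1 + u)^-1.
    rewrite (_ : _ * _ = c * (1 - rho * (1 + u)) * (1 + u)^-1).
      by rewrite c_eq mul1r.
    by field; exact: lt0r_neq0.
  nra.
apply: (@le_trans _ _ ((1 + u) ^+ d *
   ((\sum_(i < d.+1) s i * (g / (1 + u)) ^+ i) * \sum_(j < d.+1) s j * (1 + u)^-1 ^+ j))).
  rewrite natr_sum sum_johnson_ball big_distrlr /= big_distrr /=; apply: ler_sum => i _.
  have S_i : s i = #|sphere v i|%:R by rewrite card_sphere.
  apply: (@le_trans _ _ (\sum_(Y in sphere v i) (1 + u) ^+ d *
     \sum_(j < d.+1) s j * (1 + u) ^- (i + j) * g ^+ i)).
    apply: ler_sum => Y YS.
    apply: (@le_trans _ _ ((1 + u) ^+ d *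
       \sum_(Z in johnson_ball d v) (1 + u) ^- #|Y :\: Z|)).
      rewrite -sum_mem mulr_sumr; apply: ler_sum => Z ZB.
      have uD k : 0 <= (1 + u) ^+ d * (1 + u) ^- k.
        by rewrite mulr_ge0 ?invr_ge0 ?exprn_ge0.
      have [|_] := boolP (Z \in johnson_ball d Y); last exact: uD.
      rewrite inE => /andP[_ leYZ]; rewrite ler_pdivlMr ?exprn_gt0 // mul1r.
      by rewrite ler_weXn2l // lerDl.
    rewrite ler_wpM2l ?exprn_ge0 // sum_johnson_ball; apply: ler_sum => j _.
    by apply: sphere_mgf => //; rewrite -ltnS.
  rewrite sumr_const -[leLHS]mulr_natl -S_i mulrCA ler_wpM2l ?exprn_ge0 //.
  rewrite mulr_sumr; apply: ler_sum => j _.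
  rewrite exprD invfM expr_div_n exprVn.
  by rewrite le_eqVlt; apply/orP; left; apply/eqP; ring.
have s_d : s d <= (Johnson_ball_volume #|T| d w)%:R.
  by rewrite ler_nat /Johnson_ball_volume big_nat_recr //= leq_addl.
have T1 := tail (g / (1 + u)); have T2 := tail _ (lexx _).
have gu : (1 + u)^-1 <= g / (1 + u) by rewrite ler_peMl // invr_ge0.
have sum_ge0 t : 0 <= t -> 0 <= \sum_(i < d.+1) s i * t ^+ i.
  by move=> t0; apply: sumr_ge0 => i _; rewrite mulr_ge0 ?exprn_ge0.
have ui_ge0 : 0 <= (1 + u)^-1 by rewrite invr_ge0.
apply: le_trans (ler_wpM2l _ (ler_pM _ _ (T1 gu) T2)) _; rewrite ?exprn_ge0 ?sum_ge0 //.
  exact: le_trans gu.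
rewrite [leLHS](_ : _ * _ = c ^+ 2 * (g / (1 + u)) ^+ d * s d ^+ 2).
  rewrite ler_wpM2l //; last by rewrite lerXn2r ?nnegrE.
  by apply: mulr_ge0; apply: exprn_ge0; [exact: ltW | exact: le_trans gu].
have := expf_neq0 d (lt0r_neq0 u1_gt0); rewrite exprVn.
by move: ((1 + u) ^+ d) ((g / (1 + u)) ^+ d) => y z y_neq0; field.
Qed.

(** * Words of constant weight *)

Definition support n (x : word n) : {set 'I_n} := [set i | tnth x i].

Lemma support_bij n : bijective (@support n).
Proof.
exists (fun X : {set 'I_n} => [tuple i \in X | i < n]) => [x|X].
  by apply: eq_from_tnth => i; rewrite tnth_mktuple inE.
by apply/setP => i; rewrite inE tnth_mktuple.
Qed.

Lemma johnson_dist_support n (x y : word n) :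
  weight x = weight y -> johnson_dist x y = #|support x :\: support y|.
Proof.
move=> eq_w; rewrite /johnson_dist -[RHS]doubleK -addnn; congr _./2.
rewrite {2}(card_setD_sym eq_w) -cardsUI.
have -> : (support x :\: support y) :&: (support y :\: support x) = set0.
  by apply/setP => i; rewrite !inE; case: (tnth x i); case: (tnth y i).
rewrite cards0 addn0; apply: eq_card => i.
by rewrite !inE; case: (tnth x i); case: (tnth y i).
Qed.

Definition words n w : {set word n} := [set x | weight x == w].

Definition johnson_close n d : rel (word n) := fun x y => (johnson_dist x y <= d)%N.

Lemma johnson_close_refl n d : reflexive (@johnson_close n d).
Proof.
move=> x; rewrite /johnson_close /johnson_dist /hamming_dist.
by rewrite (_ : [set _ | _] = set0) ?cards0 //; apply/setP => i; rewrite !inE eqxx.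
Qed.

Lemma johnson_close_sym n d : symmetric (@johnson_close n d).
Proof.
move=> x y; rewrite /johnson_close /johnson_dist /hamming_dist.
by congr (_./2 <= d)%N; apply: eq_card => i; rewrite !inE eq_sym.
Qed.

(** Taking supports carries closeness of words to distance between sets. *)
Lemma ball_support n d w (v : word n) : v \in words n w ->
  ball (words n w) (@johnson_close n d) v = @support n @^-1: johnson_ball d (support v).
Proof.
rewrite inE => /eqP wv; apply/setP => y; rewrite !inE -wv.
rewrite -[#|support y|]/(weight y) -[#|support v|]/(weight v).
have [eq_w|//] := eqVneq (weight y) (weight v).
by rewrite /johnson_close johnson_dist_support.
Qed.

Lemma card_words n w : #|words n w| = 'C(n, w).
Proof.
rewrite -[n in RHS]card_ord -card_draws.
rewrite -(on_card_preimset (onW_bij _ (support_bij n))).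
by apply: eq_card => x; rewrite !inE.
Qed.

Lemma card_ball_words n d w (v : word n) : v \in words n w ->
  #|ball (words n w) (@johnson_close n d) v| = Johnson_ball_volume n d w.
Proof.
move=> vw; rewrite (ball_support _ vw) (on_card_preimset (onW_bij _ (support_bij n))).
rewrite card_johnson_ball card_ord; congr Johnson_ball_volume.
by move: vw; rewrite inE => /eqP.
Qed.

Lemma ball_words_intersections n d w (v : word n) : v \in words n w ->
  (\sum_(y in ball (words n w) (@johnson_close n d) v)
     #|ball (words n w) (@johnson_close n d) v :&: ball (words n w) (@johnson_close n d) y| =
   \sum_(Y in johnson_ball d (support v)) #|johnson_ball d (support v) :&: johnson_ball d Y|)%N.
Proof.
move=> vw; rewrite [RHS](reindex _ (onW_bij _ (support_bij n))) /=.
apply: eq_big => [y|y yB]; first by rewrite ball_support // inE.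
have yw : y \in words n w by move: yB; rewrite inE => /andP[].
rewrite !ball_support // -preimsetI.
exact: on_card_preimset (onW_bij _ (support_bij n)).
Qed.

Lemma independent_card_le_A n d w (I : {set word n}) :
  independent (words n w) (@johnson_close n d) I -> (#|I| <= A n d.+1 w)%N.
Proof.
move=> /independentP[sIw sepI]; apply: leq_bigmax_cond.
apply/andP; split; first by apply/forall_inP => x /sIw; rewrite inE.
apply/forall_inP => x xI; apply/forall_inP => y yI; apply/implyP.
by rewrite ltnNge; apply: contra_neqN; apply: sepI.
Qed.

Lemma Johnson_ball_volume_gt0 n d w : (0 < Johnson_ball_volume n d w)%N.
Proof. by rewrite /Johnson_ball_volume big_nat_recl // !bin0. Qed.

Lemma gilbert_varshamov n d w : ('C(n, w) <= A n d.+1 w * Johnson_ball_volume n d w)%N.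
Proof.
have [v vw|I indI leI] := @maximal_independent_set _ (words n w) (@johnson_close n d)
  (Johnson_ball_volume n d w) (@johnson_close_refl n d) (@johnson_close_sym n d).
  by rewrite card_ball_words.
by rewrite -card_words (leq_trans leI) // leq_mul2r independent_card_le_A ?orbT.
Qed.

Lemma A_ge_of_decay (R : realType) n d w (u rho c L : R) :
  0 <= u -> 0 <= rho -> rho * (1 + u) < 1 -> c = (1 - rho * (1 + u))^-1 ->
  (0 < w < n)%N -> (d <= w)%N -> (d <= n - w)%N ->
  d%:R ^+ 2 <= rho * (w - d)%:R * (n - w - d)%:R ->
  0 <= L ->
  c ^+ 2 * ((1 + u * (d%:R / w%:R)) * (1 + u * (d%:R / (n - w)%:R)) / (1 + u)) ^+ d *
    expR (4 * L + 2) <= 1 ->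
  L * 'C(n, w)%:R <= 2 * (Johnson_ball_volume n d w)%:R * (A n d.+1 w)%:R.
Proof.
move=> u_ge0 rho_ge0 rho_lt c_def /andP[w_gt0 ltwn] ledw led' rhod L_ge0 leL.
set V := Johnson_ball_volume n d w.
have V_gt0 : 0 < V%:R :> R by rewrite ltr0n Johnson_ball_volume_gt0.
have wC_gt0 : (0 < n - w)%N by rewrite subn_gt0.
have [v vw|v vw||I indI leI] := @large_independent_set R _ (words n w) (@johnson_close n d)
  V%:R (c ^+ 2 * ((1 + u * (d%:R / w%:R)) * (1 + u * (d%:R / (n - w)%:R)) / (1 + u)) ^+ d
        * V%:R ^+ 2) L (@johnson_close_refl n d) (@johnson_close_sym n d) V_gt0 L_ge0.
- by rewrite card_ball_words.
- rewrite ball_words_intersections //.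
  have cv : #|support v| = w by move: vw; rewrite inE => /eqP.
  have := @johnson_ball_intersections R _ (support v) d u rho c.
  by rewrite cv card_ord; apply.
- by rewrite mulrAC ler_piMl ?exprn_ge0.
rewrite -card_words (le_trans leI) // ler_wpM2l ?mulr_ge0 //.
by rewrite ler_nat independent_card_le_A.
Qed.

Theorem theorem2p6 (R : realType) (alpha lambda : R)
    (hlambda : 0 < lambda < 1)
    (halpha : 0 < alpha < lambda * (1 - lambda)) :
  exists2 c : R, 0 < c &
    forall n d w : nat, (0 < n)%N ->
      d%:R = alpha * n%:R -> w%:R = lambda * n%:R ->
      (A n d.+1 w)%:R >=
        c * n%:R * ('C(n, w)%:R / (Johnson_ball_volume n d w)%:R).
Proof.
move: hlambda halpha => /andP[l_gt0 l_lt1] /andP[a_gt0 a_lt].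
have al : alpha < lambda by nra.
have al' : alpha < 1 - lambda by nra.
(* kappa is the relative excess of the growth rate of the spheres at radius d:
   1 / rho = 1 + kappa. For u > 0, rho (1 + u) < 1 and q < 1 are both
   equivalent to u < kappa. *)
pose kappa := (lambda * (1 - lambda) - alpha) / alpha ^+ 2.
have kappa_gt0 : 0 < kappa by rewrite divr_gt0 ?exprn_gt0 ?subr_gt0.
pose u := kappa / 2; pose rho := (1 + kappa)^-1.
have u_gt0 : 0 < u by rewrite divr_gt0.
have k1_gt0 : 0 < 1 + kappa by rewrite addr_gt0.
have rho_gt0 : 0 < rho by rewrite invr_gt0.
have rho_lt : rho * (1 + u) < 1.
  by rewrite mulrC ltr_pdivrMr // mul1r ltrD2l /u; lra.
pose c := (1 - rho * (1 + u))^-1.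
have c_ge1 : 1 <= c.
  by rewrite invf_ge1 ?subr_gt0 // gerBl mulr_ge0 ?addr_ge0 ?ltW.
have c_gt0 : 0 < c := lt_le_trans ltr01 c_ge1.
pose q := (1 + u * (alpha / lambda)) * (1 + u * (alpha / (1 - lambda))) / (1 + u).
have l'_gt0 : 0 < 1 - lambda by rewrite subr_gt0.
have u1_gt0 : 0 < 1 + u by rewrite addr_gt0.
have ka : kappa * alpha ^+ 2 = lambda * (1 - lambda) - alpha.
  by rewrite divfK // gt_eqF ?exprn_gt0.
have q_gt0 : 0 < q.
  by rewrite divr_gt0 // mulr_gt0 // addr_gt0 // mulr_gt0 // divr_gt0.
have q_lt1 : q < 1.
  rewrite ltr_pdivrMr // mul1r -subr_gt0.
  rewrite (_ : _ - _ = u * (kappa * alpha ^+ 2 - u * alpha ^+ 2) / (lambda * (1 - lambda))).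
    apply: divr_gt0; last exact: mulr_gt0.
    by rewrite mulr_gt0 // -mulrBl mulr_gt0 ?exprn_gt0 // subr_gt0 /u; lra.
  by rewrite ka; field; rewrite !gt_eqF.
(* chosen so that c^2 q^d exp (4 L + 2) = 1 for L = a n - b *)
pose a := alpha * - ln q / 4; pose b := (1 + ln c) / 2.
have a_gt0' : 0 < a by rewrite divr_gt0 // mulr_gt0 // oppr_gt0 ln_lt0 // q_gt0.
have b_ge0 : 0 <= b by rewrite divr_ge0 // addr_ge0 // ln_ge0.
exists (a / (2 + b)) => [|n d w n_gt0 dE wE]; first by rewrite divr_gt0 // ltr_pwDl.
have nR_gt0 : 0 < n%:R :> R by rewrite ltr0n.
set N : R := 'C(n, w)%:R; set V : R := (Johnson_ball_volume n d w)%:R.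
have V_gt0 : 0 < V by rewrite ltr0n Johnson_ball_volume_gt0.
have N_ge0 : 0 <= N by rewrite ler0n.
rewrite mulrA ler_pdivrMr // mulrAC -mulrA mulrAC ler_pdivrMr ?ltr_pwDl //.
have gv : N <= (A n d.+1 w)%:R * V by rewrite -natrM ler_nat gilbert_varshamov.
have w_gt0 : (0 < w)%N by rewrite -(ltr0n R) wE mulr_gt0.
have ltwn : (w < n)%N by rewrite -(ltr_nat R) wE; nra.
have ledw : (d <= w)%N by rewrite -(ler_nat R) dE wE; nra.
have wCE : (n - w)%:R = (1 - lambda) * n%:R by rewrite natrB ?wE; [ring | exact: ltnW].
have led' : (d <= n - w)%N by rewrite -(ler_nat R) dE wCE; nra.
(* For a n < b the bound A V >= N suffices; otherwise (a n - b) N <= 2 A V and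
   b N <= b A V add up to a n N <= (2 + b) A V. *)
have [L_ge0|L_lt0] := leP 0 (a * n%:R - b); last by nra.
suff : (a * n%:R - b) * N <= 2 * V * (A n d.+1 w)%:R by nra.
apply: (@A_ge_of_decay _ _ _ _ u rho c) => //; try exact: ltW; try (by rewrite w_gt0).
  have lewn := ltnW ltwn; rewrite !natrB // dE wE.
  rewrite (_ : _ * _ * _ = rho * (1 + kappa) * (alpha * n%:R) ^+ 2).
    by rewrite mulVf ?mul1r // gt_eqF.
  rewrite (_ : rho * (1 + kappa) * _ = rho * (alpha ^+ 2 + kappa * alpha ^+ 2) * n%:R ^+ 2); last by ring.
  by rewrite ka; ring.
rewrite dE wE wCE.
rewrite (_ : _ * _ / (1 + u) = q); last first.
  by rewrite /q; field; rewrite !gt_eqF.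
rewrite -[c in c ^+ 2]lnK ?posrE // -[q in q ^+ d]lnK ?posrE //.
rewrite -!expRM_natr -!expRD dE -[leRHS]expR0 ler_expR /a /b.
by rewrite le_eqVlt; apply/orP; left; apply/eqP; field.
Qed.
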